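(* Let $(X,\mathcal{A},\mu)$ be a monotone measure space, $E\in\mathcal{A}$ and $p\ge 1$. If $\mu$ is subadditive, then for any $f,g\in\mathcal{L}^{p}_{\mu}(E)$ and any real numbers $\alpha,\beta$, we have $\alpha f+\beta g\in\mathcal{L}^{p}_{\mu}(E)$; i.e., $\mathcal{L}^{p}_{\mu}(E)$ is a linear space.
   Context: $X$ is a nonempty set and $\mathcal{A}$ a $\sigma$-algebra of subsets of $X$. A monotone measure on $(X,\mathcal{A})$ is a set function $\mu:\mathcal{A}\to[0,+\infty]$ with $\mu(\emptyset)=0$, $\mu(X)>0$, and $\mu(A)\le\mu(B)$ whenever $A\subset B$, $A,B\in\mathcal{A}$; then $(X,\mathcal{A},\mu)$ is called a monotone measure space. $\mu$ is subadditive if $\mu(A\cup B)\le\mu(A)+\mu(B)$ for all $A,B\in\mathcal{A}$. For a nonnegative real-valued measurable $h$ on $X$, the pan-integral (based on the usual $+$ and $\cdot$) is $$\int^{pan}h\,d\mu=\sup\Big\{\sum_{i=1}^{n}\lambda_i\mu(A_i):\ \sum_{i=1}^{n}\lambda_i\chi_{A_i}\le h,\ \{A_i\}_{i=1}^{n}\subset\mathcal{A}\text{ is a partition of }X,\ \lambda_i\ge 0,\ n\in\mathbb{N}\Big\}\in[0,\infty],$$ where $\chi_A$ is the characteristic function of $A$, a (finite) partition of $X$ is a finite family of pairwise disjoint sets in $\mathcal{A}$ with union $X$, and $0\cdot\infty=0$. For $E\in\mathcal{A}$ and a nonnegative measurable function $h$ on $E$, $\int_E^{pan}h\,d\mu=\int^{pan}h\cdot\chi_E\,d\mu$,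 where $h\cdot\chi_E$ is $h$ extended by $0$ outside $E$. For $p\ge1$, $\mathcal{L}^{p}_{\mu}(E)$ is the set of measurable functions $f:E\to\mathbb{R}$ with $\left(\int_E^{pan}|f|^{p}\,d\mu\right)^{1/p}<\infty$. *)

(* Defs.v *)
From mathcomp Require Import all_boot all_order all_algebra.
From mathcomp Require Import all_classical all_reals all_analysis.

Set Implicit Arguments.
Unset Strict Implicit.
Unset Printing Implicit Defensive.

Import Order.TTheory GRing.Theory Num.Theory.
Import numFieldNormedType.Exports.

Local Open Scope classical_set_scope.
Local Open Scope ring_scope.

(* Set functions are total on [set T]; only their values on measurable sets
   are constrained or used. *)
Record is_monotone_measure (d : measure_display) (T : measurableType d)
    (R : realType) (mu : set T -> \bar R) : Prop := IsMonotoneMeasure {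
  monotone_measure_ge0 : forall A, measurable A -> (0 <= mu A)%E;
  monotone_measure0 : mu set0 = 0%E;
  monotone_measureT_gt0 : (0 < mu setT)%E;
  monotone_measure_le : forall A B, measurable A -> measurable B ->
    A `<=` B -> (mu A <= mu B)%E }.

Definition subadditive_set_fun (d : measure_display) (T : measurableType d)
    (R : realType) (mu : set T -> \bar R) : Prop :=
  forall A B, measurable A -> measurable B -> (mu (A `|` B) <= mu A + mu B)%E.

(* Blocks of a partition may be empty. *)
Definition finite_measurable_partition (d : measure_display)
    (T : measurableType d) (n : nat) (A : 'I_n -> set T) : Prop :=
  [/\ forall i, measurable (A i), trivIset setT A & \bigcup_i A i = setT].

Definition pan_integral (d : measure_display) (T : measurableType d)
    (R : realType) (mu : set T -> \bar R) (h : T -> R) : \bar R :=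
  ereal_sup [set s | exists (n : nat) (l : 'I_n -> R) (A : 'I_n -> set T),
    [/\ finite_measurable_partition A,
        forall i, 0 <= l i,
        forall x, \sum_(i < n) l i * \1_(A i) x <= h x &
        s = (\sum_(i < n) (l i)%:E * mu (A i))%E]].

Definition pan_integral_on (d : measure_display) (T : measurableType d)
    (R : realType) (mu : set T -> \bar R) (E : set T) (h : T -> R) : \bar R :=
  pan_integral mu (fun x => h x * \1_E x).

(* As with [measurable_fun E f], a function on E is represented by a function
   on T; its values outside E are irrelevant. *)
Definition pan_Lp (d : measure_display) (T : measurableType d)
    (R : realType) (mu : set T -> \bar R) (E : set T) (p : R) : set (T -> R) :=
  [set f : T -> R | measurable_fun E f /\
    ((pan_integral_on mu E (fun x => `|f x| `^ p)%R) `^ p^-1 < +oo)%E].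

(* Main.v *)
Require Import Defs.
From mathcomp Require Import all_boot all_order all_algebra.
From mathcomp Require Import all_classical all_reals all_analysis.

Import Order.TTheory GRing.Theory Num.Theory.
Import numFieldNormedType.Exports.

Local Open Scope classical_set_scope.
Local Open Scope ring_scope.

(** The pan-integral is not additive in general, so the
    proof avoids sums of functions and works with maxima.  Put
    [P = {x in E | |g x| <= |f x|}].  On [P] the function
    [|alpha f + beta g| ^ p] is at most [C |f| ^ p], and on the rest of [E] it
    is at most [C |g| ^ p] (all three vanish off [E] once multiplied by its
    indicator), where [C = (|alpha| + |beta| + 1) ^ p].

    Given a partition [A] with coefficients [l] admissible for
    [|alpha f + beta g| ^ p], subadditivity bounds each [mu (A i)] by
    [mu (A i `&` P) + mu (A i `&` ~` P)].  The blocks [A i `&` P], weighted by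
    [l i / C] and completed by [~` P] with weight 0, are admissible for
    [|f| ^ p]; likewise the blocks off [P] for [|g| ^ p].  Hence the
    pan-integral of [|alpha f + beta g| ^ p] is at most [C] times the sum of
    those of [|f| ^ p] and [|g| ^ p] ([pan_integral_le_split]), which is
    finite. *)

Section PanIntegral.
#[local] Set Implicit Arguments.
#[local] Unset Strict Implicit.
Context (d : measure_display) (T : measurableType d) (R : realType).
Variable mu : set T -> \bar R.
Hypothesis mu_mon : is_monotone_measure mu.
Implicit Types (h u v : T -> R) (P E : set T).

(** Cutting a partition down to [P] leaves a family that no longer covers the
    space; adding [~` P] as an extra block of weight 0 repairs this at no cost,
    so only the behaviour of the weighted blocks on [P] matters. *)
Lemma restricted_sum_le_pan_integral u P (C : R) (n : nat) (l : 'I_n -> R)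
    (A : 'I_n -> set T) :
  measurable P -> 0 < C -> (forall x, 0 <= u x) ->
  finite_measurable_partition A -> (forall i, 0 <= l i) ->
  (forall x, P x -> \sum_(i < n) l i * \1_(A i) x <= C * u x) ->
  (\sum_(i < n) (l i)%:E * mu (A i `&` P) <= C%:E * pan_integral mu u)%E.
Proof.
move=> mP C0 u0 [mA tA cA] l0 lu.
have -> : (\sum_(i < n) (l i)%:E * mu (A i `&` P) =
    C%:E * \sum_(i < n) (l i / C)%:E * mu (A i `&` P))%E.
  rewrite ge0_sume_distrr; last first.
    move=> i _; apply: mule_ge0; first by rewrite lee_fin divr_ge0// ltW.
    by apply: (monotone_measure_ge0 mu_mon); exact: measurableI.
  apply: eq_bigr => i _.
  by rewrite muleA -EFinM mulrCA divff ?mulr1// gt_eqF.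
rewrite lee_pmul2l//; apply: ereal_sup_ubound.
exists n.+1, (fun i => if unlift ord0 i is Some j then l j / C else 0),
  (fun i => if unlift ord0 i is Some j then A j `&` P else ~` P).
split=> [|i|x|].
- split.
  + move=> i; case: unliftP => [j _|_]; first exact: measurableI.
    exact: measurableC.
  + move=> i j _ _ /=.
    case: (unliftP ord0 i) => [i' ->|->]; case: (unliftP ord0 j) => [j' ->|->].
    * by move=> [x [[Aix _] [Ajx _]]]; rewrite (tA i' j')//; exists x.
    * by move=> [x [[_ Px] nPx]].
    * by move=> [x [nPx [_ Px]]].
    * by [].
  + rewrite -subTset => x _; have [Px|nPx] := pselect (P x).
      have : (\bigcup_i A i) x by rewrite cA.
      by move=> [j _ Ajx]; exists (lift ord0 j) => //; rewrite liftK.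
    by exists ord0 => //; rewrite unlift_none.
- by case: unliftP => [j _|_] //; rewrite divr_ge0// ltW.
- rewrite big_ord_recl unlift_none mul0r add0r.
  have [Px|nPx] := pselect (P x).
    rewrite -(ler_pM2l C0); apply: le_trans (lu _ Px).
    rewrite mulr_sumr ler_sum// => i _.
    rewrite liftK mulrA mulrCA divff ?gt_eqF// mulr1 indicI/=.
    by rewrite (indicE _ P) mem_set// mulr1.
  rewrite big1// => i _.
  by rewrite liftK indicI/= (indicE _ P) memNset// !mulr0.
- rewrite big_ord_recl unlift_none mul0e add0e.
  by apply: eq_bigr => i _; rewrite liftK.
Qed.

(** This stands in for the missing additivity of the pan-integral: a function
    dominated by one function on [P] and by another off [P] is, up to the
    factor [C], integrated no higher than the two together, because
    subadditivity lets every block be cut along [P]. *)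
Lemma pan_integral_le_split h u v P (C : R) :
  subadditive_set_fun mu -> measurable P -> 0 < C ->
  (forall x, 0 <= u x) -> (forall x, 0 <= v x) ->
  (forall x, P x -> h x <= C * u x) ->
  (forall x, ~ P x -> h x <= C * v x) ->
  (pan_integral mu h <= C%:E * pan_integral mu u + C%:E * pan_integral mu v)%E.
Proof.
move=> mu_sub mP C0 u0 v0 hu hv.
apply: ge_ereal_sup => _ [n [l [A [pA l0 lh ->]]]].
have mA i : measurable (A i) by case: pA.
have mCP : measurable (~` P) by exact: measurableC.
have mu0 Q i : measurable Q -> (0 <= mu (A i `&` Q))%E.
  by move=> mQ; apply: (monotone_measure_ge0 mu_mon); exact: measurableI.
apply: (@le_trans _ _ (\sum_(i < n) (l i)%:E * mu (A i `&` P) +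
    \sum_(i < n) (l i)%:E * mu (A i `&` ~` P))%E).
  rewrite -big_split/=; apply: lee_sum => i _.
  rewrite -ge0_muleDr; [|exact: mu0..].
  apply: lee_wpmul2l; first by rewrite lee_fin.
  rewrite -{1}(setUIDK (A i) P) setDE.
  by apply: mu_sub; exact: measurableI.
apply: leeD; apply: restricted_sum_le_pan_integral => // x Px.
- exact: le_trans (lh x) (hu _ Px).
- exact: le_trans (lh x) (hv _ Px).
Qed.

(** A nonempty block of an admissible partition must have weight 0 here, and an
    empty block has measure 0, so every term of every admissible sum
    vanishes. *)
Lemma pan_integral_le0 h :
  (forall x, h x <= 0) -> (pan_integral mu h <= 0)%E.
Proof.
move=> h0; apply: ge_ereal_sup => _ [n [l [A [_ l0 lh ->]]]].
rewrite big1// => i _.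
have [->|/set0P[x Aix]] := eqVneq (A i) set0.
  by rewrite (monotone_measure0 mu_mon) mule0.
suff -> : l i = 0 by rewrite mul0e.
apply/eqP; rewrite eq_le l0 andbT.
apply: le_trans (le_trans (lh x) (h0 x)).
rewrite (bigD1 i)//= indicE mem_set// mulr1 lerDl.
by apply: sumr_ge0 => j _; rewrite mulr_ge0.
Qed.

Lemma pan_LpP E (p : R) (f : T -> R) : p != 0 ->
  pan_Lp mu E p f <-> measurable_fun E f /\
    (pan_integral_on mu E (fun x => `|f x| `^ p)%R < +oo)%E.
Proof.
move=> p0; split=> -[mf fp]; split=> //; last exact: poweR_lty.
by apply: lty_poweRy fp; rewrite invr_eq0.
Qed.

Lemma pan_Lp0 E (p : R) : 0 < p -> pan_Lp mu E p (fun=> 0).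
Proof.
move=> p0; apply/pan_LpP; first by rewrite gt_eqF.
split; first exact: measurable_cst.
apply: (@le_lt_trans _ _ 0%E) => //; apply: pan_integral_le0 => x.
by rewrite normr0 powR0 ?gt_eqF// mul0r.
Qed.

(** The [+ 1] in the constant keeps it positive when both scalars vanish. *)
Lemma powR_norm_lincomb_le (a b s t p : R) : 0 <= p -> `|t| <= `|s| ->
  `|a * s + b * t| `^ p <= (`|a| + `|b| + 1) `^ p * `|s| `^ p.
Proof.
move=> p0 ts; rewrite -powRM ?addr_ge0//.
apply: ge0_ler_powR; rewrite ?nnegrE ?mulr_ge0 ?addr_ge0//.
apply: le_trans (ler_normD _ _) _; rewrite !normrM !mulrDl mul1r -addrA.
by rewrite lerD2l ler_wpDr// ler_wpM2l.
Qed.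

Lemma pan_Lp_lincomb E (p : R) (f g : T -> R) (a b : R) :
  subadditive_set_fun mu -> measurable E -> 0 < p ->
  pan_Lp mu E p f -> pan_Lp mu E p g ->
  pan_Lp mu E p (fun x => a * f x + b * g x).
Proof.
move=> mu_sub mE p0; have pN0 : p != 0 by rewrite gt_eqF.
move=> /(pan_LpP _ _ pN0)[mf fp] /(pan_LpP _ _ pN0)[mg gp].
apply/pan_LpP => //; split.
  by apply: measurable_realfun.measurable_funD;
    apply: measurable_realfun.measurable_funM => //; exact: measurable_cst.
pose P := E `&` [set x | `|g x| <= `|f x|].
have mP : measurable P.
  by apply: measurable_fun_le => //; exact: measurableT_comp.
pose C : R := (`|a| + `|b| + 1) `^ p.
have C0 : 0 < C by rewrite powR_gt0// ltr_wpDl// addr_ge0.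
have pow_ge0 (w : T -> R) x : 0 <= `|w x| `^ p * \1_E x.
  by rewrite mulr_ge0 ?powR_ge0// indicE ler0n.
apply: le_lt_trans.
  apply: (pan_integral_le_split (h := fun x => _) mu_sub mP C0
    (pow_ge0 f) (pow_ge0 g)) => x.
  - move=> [Ex gf]; rewrite indicE mem_set// !mulr1.
    by rewrite powR_norm_lincomb_le// ltW.
  - move=> nPx; rewrite indicE; have [Ex|nEx] := boolP (x \in E).
      have fg : `|f x| <= `|g x|.
        have [//|/ltW gf] := leP `|f x| `|g x|.
        by case: nPx; split=> //; exact: set_mem.
      (* Off [P] the bound applies with [f] and [g] exchanged, hence also [a]
         and [b]; the constant is symmetric in them. *)
      by rewrite !mulr1 addrC /C (addrC `|a|) powR_norm_lincomb_le// ltW.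
    by rewrite !mulr0.
by rewrite lte_add_pinfty// lte_mul_pinfty// ?lee_fin ?ltW.
Qed.

End PanIntegral.

Theorem theorem6p1 (d : measure_display) (T : measurableType d) (R : realType)
    (mu : set T -> \bar R) (E : set T) (p : R)
    (mu_mon : is_monotone_measure mu) (mE : measurable E) (p_ge1 : 1 <= p)
    (mu_sub : subadditive_set_fun mu) :
  (forall (f g : T -> R) (alpha beta : R),
     pan_Lp mu E p f -> pan_Lp mu E p g ->
     pan_Lp mu E p (fun x => alpha * f x + beta * g x)) /\
  GRing.submod_closed [pred f : T -> R | f \in pan_Lp mu E p].
Proof.
have p0 : 0 < p by exact: lt_le_trans p_ge1.
split=> [f g a b|]; first exact: pan_Lp_lincomb.
split=> [|a f g]; rewrite !inE; first exact: pan_Lp0.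
move=> fp gp; have := pan_Lp_lincomb mu_mon a 1 mu_sub mE p0 fp gp.
by under eq_fun do rewrite mul1r.
Qed.
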